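(* Let $L>0$, $M\in\mathbb N$, $a_0,a_1,\ldots,a_M\in\mathbb C$, and $s\in(0,\pi)$. Let $P$ be any natural number with $P\ge 2M+1$, and let $(\tilde b_l)_{l\in\mathbb Z}$ and $(\tilde c_l)_{l\in\mathbb Z}$ be the $P$-periodic sequences given on $0\le l\le P-1$ by $$\tilde b_l=\begin{cases}(8l+4)a_l, & 0\le l\le M,\\ 0, & M+1\le l\le P-1,\end{cases}$$ $$\tilde c_l=\begin{cases}\dfrac13, & l=0,\\ 0, & 1\le l\le P-M-1,\\ \dfrac{1}{(2(l-P)-3)(2(l-P)-1)(2(l-P)+1)}, & P-M\le l\le P-1,\end{cases}$$ with discrete convolution $(\tilde b\ast\tilde c)_l=\sum_{n=0}^{P-1}\tilde b_n\tilde c_{l-n}$. Then $$\sum_{l = 0}^M a_l(-\Delta)_s^{1/2}e^{i(2l+1)s} = -\frac{2i}{L\pi}\sum_{l = 0}^M\frac{a_l}{2l+3} + \frac{2i}{L\pi}\sum_{l = 0}^M(\tilde b\ast\tilde c)_l\,e^{i2ls} - \frac{2i}{L\pi}\left[\cos(s) + \sin^2(s)\ln\left(\cot\left(\frac s2\right)\right)\right]\sum_{l = 0}^M(2l+1)a_l e^{i(2l+1)s}.$$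
   Context: For a bounded twice continuously differentiable function $u:\mathbb R\to\mathbb C$ (with bounded derivatives up to order two), the half Laplacian is $$(-\Delta)^{1/2}u(x) = \frac{1}{\pi}\int_{-\infty}^\infty\frac{u(x)-u(x+y)}{y^2}\,dy$$ (principal value). For $L>0$, $s\in(0,\pi)$ and an integer $k$, $(-\Delta)_s^{1/2}e^{iks}$ denotes the half Laplacian of the function $x\mapsto e^{ik\operatorname{arccot}(x/L)}$ on $\mathbb R$ ($\operatorname{arccot}$ taking values in $(0,\pi)$), evaluated at $x=L\cot(s)$. A sequence indexed by $\mathbb Z$ is $P$-periodic if its terms satisfy $b_{l+P}=b_l$ for all $l\in\mathbb Z$. *)

(* Defs.v *)
From Stdlib Require Import Reals ZArith Lra.
From Coquelicot Require Import Coquelicot.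

Open Scope R_scope.

(* Principal value of the integral over the line of a function that may be
   singular at 0: the limit, as eps tends to 0 from the right, of the improper
   integral over the complement of ]-eps, eps[.  The instance C_R_NormedModule
   makes C a normed module over R, as integration in a real variable needs. *)
Definition is_principal_value (f : R -> C) (v : C) : Prop :=
  exists Jl Jr : R -> C,
    (forall eps : R, 0 < eps ->
       is_RInt_gen (V := C_R_NormedModule) f
         (Rbar_locally m_infty) (at_point (- eps)) (Jl eps) /\
       is_RInt_gen (V := C_R_NormedModule) f
         (at_point eps) (Rbar_locally p_infty) (Jr eps)) /\
    filterlim (fun eps : R => (Jl eps + Jr eps)%C)
      (at_right 0) (locally (T := C_R_NormedModule) v).

(* Total operator in the style of [RInt_gen]: it is meaningful when the
   principal value exists. *)
Definition principal_value (f : R -> C) : C :=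
  iota (T := C_R_CompleteNormedModule) (is_principal_value f).

Lemma is_principal_value_inj (f : R -> C) (v w : C) :
  is_principal_value f v -> is_principal_value f w -> v = w.
Proof.
intros [Jl [Jr [HJ Hv]]] [Kl [Kr [HK Hw]]].
apply (filterlim_locally_unique (V := C_R_NormedModule) (F := at_right 0)
         (fun eps : R => (Jl eps + Jr eps)%C)); [exact Hv|].
apply filterlim_ext_loc with (2 := Hw).
exists posreal_one; intros eps _ Heps.
destruct (HJ eps Heps) as [H1 H2]; destruct (HK eps Heps) as [H3 H4].
apply (is_RInt_gen_unique (V := C_R_CompleteNormedModule)) in H1, H2, H3, H4.
congruence.
Qed.

Lemma is_principal_value_unique (f : R -> C) (v : C) :
  is_principal_value f v -> principal_value f = v.
Proof.
intros Hv; apply (iota_unique (V := C_R_CompleteNormedModule)); [|exact Hv].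
intros w Hw; exact (is_principal_value_inj f w v Hw Hv).
Qed.

Definition half_laplacian (u : R -> C) (x : R) : C :=
  (RtoC (1 / PI) *
     principal_value (fun y : R => (u x - u (x + y)%R) / RtoC (y ^ 2)))%C.

(* e^(i t) for real t. *)
Definition expi (t : R) : C := (cos t, sin t).

Definition cot (x : R) : R := cos x / sin x.

(* The branch of the inverse cotangent with values in ]0, PI[. *)
Definition arccot (x : R) : R := PI / 2 - atan x.

(* The half Laplacian in the variable s, where x = L * cot s, of e^(i k s). *)
Definition half_laplacian_expi (L : R) (k : Z) (s : R) : C :=
  half_laplacian (fun x : R => expi (IZR k * arccot (x / L))) (L * cot s).

Definition periodic (P : nat) (b : Z -> C) : Prop :=
  forall l : Z, b (l + Z.of_nat P)%Z = b l.

(* Discrete convolution over one period, the indices 0 <= n <= P - 1. *)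
Definition conv (P : nat) (b c : Z -> C) (l : Z) : C :=
  sum_n (G := C_AbelianMonoid)
    (fun n : nat => (b (Z.of_nat n) * c (l - Z.of_nat n)%Z)%C) (P - 1).

(* Main.v *)
Require Import Defs.
From Stdlib Require Import Reals ZArith Lra Lia.
From Coquelicot Require Import Coquelicot.
Open Scope R_scope.

(** Put x + y = L cot t and tau = t - s.  After division by e^(iks), the integrand
    of the half Laplacian of e^(iks) is g_k(y) = (1 - e^(ik tau)) / y^2, and
      g_(k+2) - 2 g_k + g_(k-2) = 4 sin^2(tau) e^(ik tau) / y^2,
    which is no longer singular, since sin^2(tau) / y^2 = sin^2(s) sin^2(t) / L^2
    = - sin^2(s) t'(y) / L; it integrates to 8 i sin^2(s) e^(-iks) / (L k) when
    k is odd.  The principal values for k = 1 and k = -1 come from the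
    antiderivatives tan(tau/2) and ln |tan(tau/2)| of 1 / (1 + cos tau) and
    1 / sin tau.  The closed form satisfies the same second order recurrence in k,
    and the period condition P >= 2M + 1 makes the convolution free of aliasing
    on the indices 0 .. M. *)

(** * Principal values computed from antiderivatives *)

(* The equation with [psi] says that the part of the antiderivative [F] that is
   singular at 0 is even, so that it cancels in the principal value. *)
Definition has_antiderivative_pv (f : R -> R) (v : R) : Prop :=
  exists (F psi : R -> R) (lm lp : R),
    (forall y, y <> 0 -> is_derive F y (f y)) /\
    (forall y, y <> 0 -> continuous f y) /\
    filterlim F (Rbar_locally m_infty) (locally lm) /\
    filterlim F (Rbar_locally p_infty) (locally lp) /\
    continuous psi 0 /\
    (forall y, 0 < y -> F y - F (- y) = psi y - psi (- y)) /\
    v = lp - lm.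

Lemma filterlim_lin_comb {T} (F : (T -> Prop) -> Prop) {FF : Filter F}
  (f g : T -> R) (a b l m : R) :
  filterlim f F (locally l) -> filterlim g F (locally m) ->
  filterlim (fun t => a * f t + b * g t) F (locally (a * l + b * m)).
Proof.
intros Hf Hg.
apply (filterlim_comp_2 (G := locally (a * l)) (H := locally (b * m))
  (fun t => a * f t) (fun t => b * g t) Rplus).
- exact (filterlim_comp _ _ _ _ _ _ _ _ Hf (filterlim_scal_r (V := R_NormedModule) a l)).
- exact (filterlim_comp _ _ _ _ _ _ _ _ Hg (filterlim_scal_r (V := R_NormedModule) b m)).
- exact (filterlim_plus (V := R_NormedModule) (a * l) (b * m)).
Qed.

Lemma has_antiderivative_pv_lin_comb (f g h : R -> R) (a b v w z : R) :
  has_antiderivative_pv f v -> has_antiderivative_pv g w ->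
  (forall y, y <> 0 -> h y = a * f y + b * g y) -> z = a * v + b * w ->
  has_antiderivative_pv h z.
Proof.
intros (F & p & lm & lp & HF & Cf & Fm & Fp & Cp & Ep & ->)
  (G & q & mm & mp & HG & Cg & Gm & Gp & Cq & Eq & ->) Hh ->.
exists (fun y => a * F y + b * G y), (fun y => a * p y + b * q y),
  (a * lm + b * mm), (a * lp + b * mp).
split; [|split; [|split; [|split; [|split; [|split]]]]].
- intros y Hy; rewrite (Hh y Hy).
  apply (is_derive_plus (V := R_NormedModule) (fun y => a * F y) (fun y => b * G y));
  apply is_derive_scal; auto.
- intros y Hy.
  apply continuous_ext_loc with (fun y => a * f y + b * g y).
  (* The ball of radius |y| around y misses 0, where [Hh] says nothing. *)
  + exists (mkposreal _ (Rabs_pos_lt _ Hy)); intros u Hu; symmetry; apply Hh.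
    intros ->; revert Hu; unfold ball; simpl; unfold AbsRing_ball, abs, minus, plus, opp; simpl.
    rewrite Rplus_0_l, Rabs_Ropp; lra.
  + exact (filterlim_lin_comb (locally y) f g a b _ _ (Cf y Hy) (Cg y Hy)).
- now apply (filterlim_lin_comb (Rbar_locally m_infty)).
- now apply (filterlim_lin_comb (Rbar_locally p_infty)).
- exact (filterlim_lin_comb (locally 0) p q a b _ _ Cp Cq).
- intros y Hy; generalize (Ep y Hy) (Eq y Hy); intros E1 E2.
  replace (F y) with (F (- y) + (p y - p (- y))) by lra.
  replace (G y) with (G (- y) + (q y - q (- y))) by lra.
  ring.
- ring.
Qed.

(** Stated for two arbitrary filters so that it serves both half-lines, each with one finite and one
    infinite end. *)
Lemma is_RInt_gen_antiderivative (Fa Fb : (R -> Prop) -> Prop)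
  {FFa : Filter Fa} {FFb : Filter Fb} (f F : R -> R) (la lb : R) :
  filter_prod Fa Fb (fun ab => forall y,
    Rmin (fst ab) (snd ab) <= y <= Rmax (fst ab) (snd ab) ->
    is_derive F y (f y) /\ continuous f y) ->
  filterlim F Fa (locally la) -> filterlim F Fb (locally lb) ->
  is_RInt_gen f Fa Fb (lb - la).
Proof.
intros H Ha Hb P HP.
assert (Hlim : filterlim (fun ab => F (snd ab) - F (fst ab)) (filter_prod Fa Fb)
    (locally (lb - la))).
{ replace (lb - la) with (1 * lb + (-1) * la) by ring.
  apply (filterlim_ext (fun ab : R * R => 1 * F (snd ab) + (-1) * F (fst ab))).
  - intros ab; ring.
  - apply (filterlim_lin_comb (filter_prod Fa Fb)).
    + exact (filterlim_comp _ _ _ _ _ _ _ _ filterlim_snd Hb).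
    + exact (filterlim_comp _ _ _ _ _ _ _ _ filterlim_fst Ha). }
specialize (Hlim P HP); unfold filtermap in Hlim; unfold filtermapi.
generalize (filter_and _ _ H Hlim); apply filter_imp.
intros [u v] [H1 H2]; exists (F v - F u); split; [|exact H2].
apply (is_RInt_derive F f); intros y Hy; now apply (H1 y).
Qed.

Lemma is_RInt_gen_C (Fa Fb : (R -> Prop) -> Prop)
  {FFa : Filter Fa} {FFb : Filter Fb} (f : R -> C) (l : C) :
  is_RInt_gen (fun y => fst (f y)) Fa Fb (fst l) ->
  is_RInt_gen (fun y => snd (f y)) Fa Fb (snd l) ->
  is_RInt_gen (V := C_R_NormedModule) f Fa Fb l.
Proof.
intros H1 H2 P [e He].
specialize (H1 _ (locally_ball (fst l) e)); specialize (H2 _ (locally_ball (snd l) e)).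
unfold filtermapi in *.
generalize (filter_and _ _ H1 H2); apply filter_imp.
intros [u v] [[v1 [I1 B1]] [v2 [I2 B2]]].
exists (v1, v2); split.
- exact (is_RInt_fct_extend_pair (U := R_NormedModule) (V := R_NormedModule)
    f u v v1 v2 I1 I2).
- apply He; split; assumption.
Qed.

(** This difference is the error left in the integral by cutting out the interval between -e and
    e. *)
Lemma at_right_opp_continuous (psi : R -> R) :
  continuous psi 0 ->
  filterlim (fun e => psi (- e) - psi e) (at_right 0) (locally 0).
Proof.
intros H.
replace (locally 0) with (locally (1 * psi 0 + (-1) * psi 0)) by (f_equal; ring).
apply (filterlim_ext (fun e => 1 * psi (- e) + (-1) * psi e)); [intros e; ring|].
apply (filterlim_filter_le_1 _ (filter_le_within (fun u => 0 < u))).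
assert (Hm : continuous (fun e => psi (- e)) 0).
{ apply (continuous_comp Ropp psi).
  - apply (continuous_opp (V := R_NormedModule)), continuous_id.
  - rewrite Ropp_0; exact H. }
unfold continuous in Hm; rewrite Ropp_0 in Hm.
now apply (filterlim_lin_comb (locally 0)).
Qed.

(** The two half-line integrals are F(-e) - lm and lp - F(e). Their sum is v + F(-e) - F(e), and the
    last two terms may be replaced by psi(-e) - psi(e), which tends to 0. *)
Lemma has_antiderivative_pv_RInt_gen (f : R -> R) (v : R) :
  has_antiderivative_pv f v ->
  exists Jl Jr : R -> R,
    (forall eps : R, 0 < eps ->
       is_RInt_gen f (Rbar_locally m_infty) (at_point (- eps)) (Jl eps) /\
       is_RInt_gen f (at_point eps) (Rbar_locally p_infty) (Jr eps)) /\
    filterlim (fun eps : R => Jl eps + Jr eps) (at_right 0) (locally v).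
Proof.
intros (F & p & lm & lp & HF & Cf & Fm & Fp & Cp & Ep & ->).
assert (Hpt : forall z, filterlim F (at_point z) (locally (F z))).
{ intros z P HP; exact (locally_singleton _ _ HP). }
exists (fun e => F (- e) - lm), (fun e => lp - F e); split.
- intros e He; split; apply (is_RInt_gen_antiderivative _ _ _ F); auto.
  + exists (fun u => u < - e) (fun u => u = - e).
    * now exists (- e).
    * reflexivity.
    * intros u w Hu -> y; simpl; rewrite Rmax_right by lra; intros [_ Hy].
      split; [apply HF|apply Cf]; lra.
  + exists (fun u => u = e) (fun u => e < u).
    * reflexivity.
    * now exists e.
    * intros u w -> Hw y; simpl; rewrite Rmin_left by lra; intros [Hy _].
      split; [apply HF|apply Cf]; lra.
- replace (lp - lm) with (1 * (lp - lm) + 1 * 0) by ring.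
  apply filterlim_ext_loc with (fun e => 1 * (lp - lm) + 1 * (p (- e) - p e)).
  + exists posreal_one; intros e _ He; generalize (Ep e He); simpl; lra.
  + apply (filterlim_lin_comb (at_right 0)).
    * apply filterlim_const.
    * now apply at_right_opp_continuous.
Qed.

Lemma is_principal_value_C (f : R -> C) (v : C) :
  has_antiderivative_pv (fun y => fst (f y)) (fst v) ->
  has_antiderivative_pv (fun y => snd (f y)) (snd v) ->
  is_principal_value f v.
Proof.
intros H1 H2.
destruct (has_antiderivative_pv_RInt_gen _ _ H1) as (Jl1 & Jr1 & HJ1 & L1).
destruct (has_antiderivative_pv_RInt_gen _ _ H2) as (Jl2 & Jr2 & HJ2 & L2).
exists (fun e => (Jl1 e, Jl2 e)), (fun e => (Jr1 e, Jr2 e)); split.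
- intros e He; destruct (HJ1 e He); destruct (HJ2 e He).
  split.
  + now apply (is_RInt_gen_C (Rbar_locally m_infty) (at_point (- e))).
  + now apply (is_RInt_gen_C (at_point e) (Rbar_locally p_infty)).
- intros P [e He].
  specialize (L1 _ (locally_ball (fst v) e)); specialize (L2 _ (locally_ball (snd v) e)).
  unfold filtermap in *.
  generalize (filter_and _ _ L1 L2); apply filter_imp.
  intros u [B1 B2]; apply He; split; assumption.
Qed.

(** * The inverse cotangent *)

Lemma arccot_bounds (x : R) : 0 < arccot x < PI.
Proof. unfold arccot; generalize (atan_bound x); lra. Qed.

Lemma sin_arccot_pos (x : R) : 0 < sin (arccot x).
Proof. generalize (arccot_bounds x); intros [H1 H2]; now apply sin_gt_0. Qed.

Lemma cos_arccot (x : R) : cos (arccot x) = x * sin (arccot x).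
Proof.
unfold arccot; rewrite cos_shift, sin_shift, sin_atan, cos_atan; field.
apply Rgt_not_eq, sqrt_lt_R0; generalize (Rle_0_sqr x); lra.
Qed.

(** The form - sin^2 of the usual - 1 / (1 + x^2) keeps everything a function of the angle after the
    change of variable. *)
Lemma is_derive_arccot (x : R) : is_derive arccot x (- sin (arccot x) ^ 2).
Proof.
replace (- sin (arccot x) ^ 2) with (- / (1 + x ^ 2)).
- unfold arccot; auto_derive; [trivial|field; nra].
- generalize (cos_arccot x) (sin2_cos2 (arccot x)); unfold Rsqr.
  intros ->; intros H; apply Rmult_eq_reg_r with (1 + x ^ 2); [|nra].
  transitivity (- 1); [field; nra|lra].
Qed.

Lemma arccot_cot (s : R) : 0 < s < PI -> arccot (cot s) = s.
Proof.
intros Hs; unfold arccot.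
replace (cot s) with (tan (PI / 2 - s)).
- rewrite atan_tan; lra.
- unfold tan, cot; now rewrite sin_shift, cos_shift.
Qed.

Lemma filterlim_arccot_p_infty : filterlim arccot (Rbar_locally p_infty) (locally 0).
Proof.
intros P [e He].
(* The cap at 1 keeps PI/2 - d in the range where [atan] inverts [tan]. *)
set (d := Rmin e 1).
assert (Hd : 0 < d <= 1).
{ split; [apply Rmin_pos; [apply cond_pos|lra]|apply Rmin_r]. }
exists (tan (PI / 2 - d)); intros x Hx; apply He.
assert (H : PI / 2 - d < atan x).
{ rewrite <- (atan_tan (PI / 2 - d)); [now apply atan_increasing|].
  generalize PI2_1; lra. }
generalize (arccot_bounds x) (Rmin_l e 1); fold d; intros Hb Hde.
unfold ball; simpl; unfold AbsRing_ball, abs, minus, plus, opp; simpl.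
unfold arccot in *; rewrite Rabs_right; lra.
Qed.

Lemma filterlim_arccot_m_infty : filterlim arccot (Rbar_locally m_infty) (locally PI).
Proof.
apply (filterlim_ext (fun x => PI - arccot (- x))).
{ intros x; unfold arccot; rewrite atan_opp; lra. }
replace (locally PI) with (locally (1 * PI + (-1) * 0)) by (f_equal; ring).
apply (filterlim_ext (fun x => 1 * PI + (-1) * arccot (- x))); [intros x; ring|].
apply (filterlim_lin_comb (Rbar_locally m_infty)).
- apply filterlim_const.
- apply filterlim_comp with (2 := filterlim_arccot_p_infty).
  exact (filterlim_Rbar_opp m_infty).
Qed.

(** * The change of variable from y to t *)

(* The variable t with [x + y = L cot t], for [x = L cot s]. *)
Definition theta (L s y : R) : R := arccot ((L * cot s + y) / L).

Lemma theta_0 (L s : R) : 0 < L -> 0 < s < PI -> theta L s 0 = s.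
Proof.
intros HL Hs; unfold theta.
replace ((L * cot s + 0) / L) with (cot s) by (field; lra).
now apply arccot_cot.
Qed.

Lemma is_derive_theta (L s y : R) : 0 < L ->
  is_derive (theta L s) y (- sin (theta L s y) ^ 2 / L).
Proof.
intros HL; unfold theta.
replace (- sin (arccot ((L * cot s + y) / L)) ^ 2 / L)
  with (scal (/ L) (- sin (arccot ((L * cot s + y) / L)) ^ 2))
  by (unfold scal; simpl; unfold mult; simpl; field; lra).
apply (is_derive_comp arccot (fun y => (L * cot s + y) / L)).
- apply is_derive_arccot.
- auto_derive; [trivial|field; lra].
Qed.

Lemma filterlim_theta_p_infty (L s : R) : 0 < L ->
  filterlim (theta L s) (Rbar_locally p_infty) (locally 0).
Proof.
intros HL; unfold theta.
apply filterlim_comp with (2 := filterlim_arccot_p_infty).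
intros Q [N HN]; exists (L * N - L * cot s); intros y Hy; apply HN.
apply Rmult_lt_reg_l with L; [easy|].
replace (L * ((L * cot s + y) / L)) with (L * cot s + y) by (field; lra); lra.
Qed.

Lemma filterlim_theta_m_infty (L s : R) : 0 < L ->
  filterlim (theta L s) (Rbar_locally m_infty) (locally PI).
Proof.
intros HL; unfold theta.
apply filterlim_comp with (2 := filterlim_arccot_m_infty).
intros Q [N HN]; exists (L * N - L * cot s); intros y Hy; apply HN.
apply Rmult_lt_reg_l with L; [easy|].
replace (L * ((L * cot s + y) / L)) with (L * cot s + y) by (field; lra); lra.
Qed.

(** This is cot t - cot s = y / L cleared of denominators, with cot t - cot s = sin(s - t) / (sin s
    sin t). It is the source of every cancellation of the singularity at y = 0. *)
Lemma theta_chord (L s y : R) : 0 < L -> 0 < s < PI ->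
  L * sin (theta L s y - s) = - (y * (sin s * sin (theta L s y))).
Proof.
intros HL Hs; assert (0 < sin s) by (apply sin_gt_0; lra).
rewrite sin_minus; unfold theta at 2; rewrite cos_arccot; fold (theta L s y).
unfold cot; field; lra.
Qed.

Lemma theta_bounds (L s y : R) : 0 < theta L s y < PI.
Proof. apply arccot_bounds. Qed.

(** At t = s the chord identity would reduce to y sin^2(s) = 0. *)
Lemma theta_neq (L s y : R) : 0 < L -> 0 < s < PI -> y <> 0 -> theta L s y <> s.
Proof.
intros HL Hs Hy E; generalize (theta_chord L s y HL Hs).
rewrite E, Rminus_diag, sin_0; intros H.
assert (0 < sin s) by (apply sin_gt_0; lra).
assert (0 < sin s * sin s) by now apply Rmult_lt_0_compat.
assert (E2 : y * (sin s * sin s) = 0) by lra.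
apply Rmult_integral in E2; lra.
Qed.

Lemma sin2_div_y2 (L s y : R) : 0 < L -> 0 < s < PI -> y <> 0 ->
  sin (theta L s y - s) ^ 2 / y ^ 2 = (sin s * sin (theta L s y) / L) ^ 2.
Proof.
intros HL Hs Hy.
replace (sin (theta L s y - s)) with (- (y * (sin s * sin (theta L s y))) / L).
- field; lra.
- rewrite <- theta_chord by easy; field; lra.
Qed.

(** When y runs from minus to plus infinity, t runs from PI down to 0, whence the value phi 0 - phi
    PI. The singular point y = 0 sits at t = s, where continuity is asked of [psi] alone. *)
Lemma has_antiderivative_pv_theta (L s : R) (phi dphi psi f : R -> R) (v : R) :
  0 < L -> 0 < s < PI ->
  (forall t, 0 < t < PI -> t <> s -> is_derive phi t (dphi t)) ->
  (forall t, 0 < t < PI -> t <> s -> continuous dphi t) ->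
  continuous phi 0 -> continuous phi PI -> continuous psi s ->
  (forall y, 0 < y ->
     phi (theta L s y) - phi (theta L s (- y)) =
     psi (theta L s y) - psi (theta L s (- y))) ->
  (forall y, y <> 0 -> f y = - sin (theta L s y) ^ 2 / L * dphi (theta L s y)) ->
  v = phi 0 - phi PI ->
  has_antiderivative_pv f v.
Proof.
intros HL Hs Hd Hc H0 Hpi Hpsi Hodd Hf ->.
assert (Cth : forall y, continuous (theta L s) y).
{ intros y; apply (ex_derive_continuous (V := R_NormedModule)).
  eexists; now apply is_derive_theta. }
(* [f] agrees with the substituted integrand only off 0; the combination with coefficients 1 and 0
   carries the value over. *)
cut (has_antiderivative_pv
  (fun y => - sin (theta L s y) ^ 2 / L * dphi (theta L s y)) (phi 0 - phi PI)).
{ intros H; apply (has_antiderivative_pv_lin_comb _ _ f 1 0 _ _ _ H H); [|ring].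
  intros y Hy; rewrite (Hf y Hy); ring. }
exists (fun y => phi (theta L s y)), (fun y => psi (theta L s y)), (phi PI), (phi 0).
split; [|split; [|split; [|split; [|split; [|split]]]]].
- intros y Hy.
  apply (is_derive_comp phi (theta L s)); [|now apply is_derive_theta].
  apply Hd; [apply theta_bounds|now apply theta_neq].
- intros y Hy.
  apply (continuous_mult (K := R_AbsRing)).
  + apply (continuous_comp (theta L s) (fun t => - sin t ^ 2 / L)); [apply Cth|].
    apply (ex_derive_continuous (V := R_NormedModule)); auto_derive; lra.
  + apply (continuous_comp (theta L s) dphi); [apply Cth|].
    apply Hc; [apply theta_bounds|now apply theta_neq].
- exact (filterlim_comp _ _ _ _ _ _ _ _ (filterlim_theta_m_infty L s HL) Hpi).
- exact (filterlim_comp _ _ _ _ _ _ _ _ (filterlim_theta_p_infty L s HL) H0).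
- apply (continuous_comp (theta L s) psi); [apply Cth|now rewrite theta_0].
- exact Hodd.
- ring.
Qed.

(** * Principal values of the real and imaginary parts for k = 1 *)

(** Since s is interior, |t - s| < PI even at t = 0 and t = PI, so tan(tau/2) is regular on the
    whole closed interval. *)
Lemma half_angle_cos_pos (s t : R) : 0 < s < PI -> 0 <= t <= PI -> 0 < cos ((t - s) / 2).
Proof. intros Hs Ht; apply cos_gt_0; lra. Qed.

Lemma half_angle (u : R) :
  1 + cos u = 2 * cos (u / 2) ^ 2 /\ sin u = 2 * sin (u / 2) * cos (u / 2).
Proof.
replace (cos u) with (cos (2 * (u / 2))) by (f_equal; field).
replace (sin u) with (sin (2 * (u / 2))) by (f_equal; field).
rewrite cos_2a_cos, sin_2a; split; ring.
Qed.

(** Writing 1 - cos tau = sin^2(tau) / (1 + cos tau) removes the singularity, so the antiderivative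
    is its own regular part. The end values give sin^2(s) (tan(s/2) + cot(s/2)) / L = 2 sin(s) /
    L. *)
Lemma pv_one_minus_cos (L s : R) : 0 < L -> 0 < s < PI ->
  has_antiderivative_pv (fun y => (1 - cos (theta L s y - s)) / y ^ 2) (2 * sin s / L).
Proof.
intros HL Hs.
assert (Cphi : forall t, 0 <= t <= PI ->
  is_derive (fun t => - (sin s ^ 2 / L) * tan ((t - s) / 2)) t
    (- (sin s ^ 2 / L) / (1 + cos (t - s)))).
{ intros t Ht; generalize (half_angle_cos_pos s t Hs Ht); intros Hc.
  destruct (half_angle (t - s)) as [E _]; rewrite E.
  unfold tan; auto_derive.
  - change ((t + - s) * / 2) with ((t - s) / 2); lra.
  - generalize (sin2_cos2 ((t - s) / 2)); unfold Rsqr.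
    change ((t + - s) * / 2) with ((t - s) / 2).
    intros E2; field_simplify; [|lra|lra].
    f_equal; nra. }
assert (Cc : forall t, 0 <= t <= PI ->
  continuous (fun t => - (sin s ^ 2 / L) * tan ((t - s) / 2)) t).
{ intros t Ht; apply (ex_derive_continuous (V := R_NormedModule)).
  eexists; now apply Cphi. }
apply (has_antiderivative_pv_theta L s (fun t => - (sin s ^ 2 / L) * tan ((t - s) / 2))
  (fun t => - (sin s ^ 2 / L) / (1 + cos (t - s)))
  (fun t => - (sin s ^ 2 / L) * tan ((t - s) / 2))); try easy.
- intros t Ht _; apply Cphi; lra.
- intros t Ht _; apply (ex_derive_continuous (V := R_NormedModule)); auto_derive.
  destruct (half_angle (t - s)) as [E _].
  assert (Hc : 0 < cos ((t - s) / 2)) by (apply half_angle_cos_pos; lra).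
  unfold Rminus in E, Hc |- *; nra.
- apply Cc; lra.
- apply Cc; lra.
- apply Cc; lra.
- intros y Hy; cbv beta.
  generalize (sin2_div_y2 L s y HL Hs Hy) (sin2_cos2 (theta L s y - s)); unfold Rsqr.
  destruct (half_angle (theta L s y - s)) as [E _].
  assert (Hc : 0 < cos ((theta L s y - s) / 2)).
  { apply half_angle_cos_pos; [easy|generalize (theta_bounds L s y); lra]. }
  set (c := cos (theta L s y - s)) in *.
  intros E1 E2; assert (Hp : 0 < 1 + c) by (rewrite E; nra).
  replace ((1 - c) / y ^ 2) with (sin (theta L s y - s) ^ 2 / y ^ 2 / (1 + c)).
  + rewrite E1; field; lra.
  + replace (sin (theta L s y - s) ^ 2) with ((1 - c) * (1 + c)) by lra; field; lra.
- replace ((PI - s) / 2) with (PI / 2 - s / 2) by field.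
  replace ((0 - s) / 2) with (- (s / 2)) by field.
  rewrite tan_neg; unfold tan; rewrite sin_shift, cos_shift.
  assert (0 < sin (s / 2)) by (apply sin_gt_0; lra).
  assert (0 < cos (s / 2)) by (apply cos_gt_0; lra).
  destruct (half_angle s) as [_ E]; rewrite E.
  generalize (sin2_cos2 (s / 2)); unfold Rsqr; intros E2.
  (* The numerator sin^2 + cos^2 of tan(s/2) + cot(s/2) is kept as a factor, so that [field] can
     check the rest. *)
  transitivity (2 * (2 * sin (s / 2) * cos (s / 2))
    * (sin (s / 2) * sin (s / 2) + cos (s / 2) * cos (s / 2)) / L).
  + rewrite E2; field; lra.
  + field; lra.
Qed.

(** Near 0 the integrand behaves like a multiple of 1/y. Its antiderivative ln |tan(tau/2)|, up to a
    factor, is ln |y| plus a function continuous at 0, and ln |y| is even. *)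
Lemma pv_sin (L s : R) : 0 < L -> 0 < s < PI ->
  has_antiderivative_pv (fun y => sin (theta L s y - s) / y ^ 2)
    (2 * sin s ^ 2 * ln (cot (s / 2)) / L).
Proof.
intros HL Hs.
assert (Hss : 0 < sin s) by (apply sin_gt_0; lra).
assert (Hden : forall t, 0 <= t <= PI -> 0 < 1 + cos (t - s)).
{ intros t Ht; destruct (half_angle (t - s)) as [-> _].
  generalize (half_angle_cos_pos s t Hs Ht); nra. }
assert (Hsin : forall t, 0 <= t <= PI -> t <> s -> sin ((t - s) / 2) <> 0).
{ intros t Ht Hts; destruct (Rlt_or_le t s).
  - apply Rlt_not_eq; replace ((t - s) / 2) with (- ((s - t) / 2)) by field.
    rewrite sin_neg; apply Ropp_lt_gt_0_contravar, sin_gt_0; lra.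
  - apply Rgt_not_eq, sin_gt_0; lra. }
assert (Htan : forall t, 0 <= t <= PI -> t <> s -> 0 < tan ((t - s) / 2) ^ 2).
{ intros t Ht Hts; apply pow2_gt_0; unfold tan.
  generalize (half_angle_cos_pos s t Hs Ht); intros Hc.
  apply Rmult_integral_contrapositive; split; [now apply Hsin|].
  apply Rinv_neq_0_compat; lra. }
(* The square under the logarithm replaces an absolute value, whence the factor 2 beside L. [psi] is
   what remains of [phi] once ln(y^2) is split off. *)
set (phi := fun t => - (sin s ^ 2 / (2 * L)) * ln (tan ((t - s) / 2) ^ 2)).
set (psi := fun t =>
  - (sin s ^ 2 / (2 * L)) * ln ((sin s * sin t / (L * (1 + cos (t - s)))) ^ 2)).
assert (Cphi : forall t, 0 <= t <= PI -> t <> s ->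
  is_derive phi t (- (sin s ^ 2 / L) / sin (t - s))).
{ intros t Ht Hts.
  generalize (half_angle_cos_pos s t Hs Ht) (Hsin t Ht Hts) (Htan t Ht Hts).
  destruct (half_angle (t - s)) as [_ E]; rewrite E.
  unfold phi, tan; intros Hc Hn Hp; auto_derive.
  - change ((t + - s) * / 2) with ((t - s) / 2); split; [lra|split; [|easy]].
    unfold Rdiv in *; simpl in Hp; exact Hp.
  - generalize (sin2_cos2 ((t - s) / 2)); unfold Rsqr.
    change ((t + - s) * / 2) with ((t - s) / 2).
    set (u := sin ((t - s) / 2)) in *; set (w := cos ((t - s) / 2)) in *.
    intros E2; transitivity (- (sin s ^ 2 / L) / (2 * u * w) * (u * u + w * w)).
    + field; repeat split; lra.
    + rewrite E2; ring. }
assert (Cc : forall t, 0 <= t <= PI -> t <> s -> continuous phi t).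
{ intros t Ht Hts; apply (ex_derive_continuous (V := R_NormedModule)).
  eexists; now apply Cphi. }
apply (has_antiderivative_pv_theta L s phi
  (fun t => - (sin s ^ 2 / L) / sin (t - s)) psi); try easy.
- intros t Ht Hts; apply Cphi; [lra|easy].
- intros t Ht Hts; apply (ex_derive_continuous (V := R_NormedModule)); auto_derive.
  change (t + - s) with (t - s); destruct (half_angle (t - s)) as [_ ->].
  assert (H1 : 0 < cos ((t - s) / 2)) by (apply half_angle_cos_pos; lra).
  assert (H2 := Hsin t ltac:(lra) Hts).
  repeat apply Rmult_integral_contrapositive_currified; lra.
- apply Cc; lra.
- apply Cc; lra.
- apply (ex_derive_continuous (V := R_NormedModule)); unfold psi; auto_derive.
  change (s + - s) with (s - s); rewrite Rminus_diag, cos_0, !Rmult_1_r.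
  assert (0 < L * (1 + 1)) by lra.
  repeat split; try lra.
  assert (0 < sin s * sin s * / (L * (1 + 1))).
  { apply Rmult_lt_0_compat; [nra|now apply Rinv_0_lt_compat]. }
  nra.
(* tan (tau/2) = sin tau / (1 + cos tau) is y times a function of t that does
   not vanish at s. *)
- assert (Hphi : forall y, y <> 0 ->
    phi (theta L s y) = - (sin s ^ 2 / (2 * L)) * ln (y ^ 2) + psi (theta L s y)).
  { intros y Hy; unfold phi, psi.
    assert (Hb : 0 <= theta L s y <= PI) by (generalize (theta_bounds L s y); lra).
    assert (Hq : 0 < sin s * sin (theta L s y) / (L * (1 + cos (theta L s y - s)))).
    { generalize (Hden _ Hb) (sin_arccot_pos ((L * cot s + y) / L)); fold (theta L s y).
      intros Hd Ht.
      apply Rmult_lt_0_compat; [nra|apply Rinv_0_lt_compat; nra]. }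
    rewrite <- Rmult_plus_distr_l, <- ln_mult.
    - f_equal; f_equal.
      generalize (Hden _ Hb) (half_angle_cos_pos s _ Hs Hb); intros Hd Hc.
      replace (tan ((theta L s y - s) / 2)) with
        (sin (theta L s y - s) / (1 + cos (theta L s y - s))).
      + replace (sin (theta L s y - s))
          with (- (y * (sin s * sin (theta L s y))) / L).
        * field; lra.
        * rewrite <- theta_chord by easy; field; lra.
      + destruct (half_angle (theta L s y - s)) as [-> ->]; unfold tan; field; lra.
    - now apply pow2_gt_0.
    - apply pow_lt, Hq. }
  intros y Hy; rewrite !Hphi by lra.
  replace ((- y) ^ 2) with (y ^ 2) by ring; ring.
- intros y Hy; cbv beta.
  generalize (sin2_div_y2 L s y HL Hs Hy).
  assert (Hn : sin (theta L s y - s) <> 0).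
  { intros E; generalize (theta_chord L s y HL Hs); rewrite E.
    generalize (sin_arccot_pos ((L * cot s + y) / L)); fold (theta L s y); intros Ht Hz.
    assert (E2 : y * (sin s * sin (theta L s y)) = 0) by lra.
    apply Rmult_integral in E2; destruct E2; [easy|nra]. }
  intros E1.
  transitivity (sin (theta L s y - s) ^ 2 / y ^ 2 / sin (theta L s y - s));
    [field; easy|rewrite E1; field; lra].
- unfold phi.
  replace ((PI - s) / 2) with (PI / 2 - s / 2) by field.
  replace ((0 - s) / 2) with (- (s / 2)) by field.
  rewrite tan_neg; unfold tan, cot; rewrite sin_shift, cos_shift.
  assert (0 < sin (s / 2)) by (apply sin_gt_0; lra).
  assert (0 < cos (s / 2)) by (apply cos_gt_0; lra).
  (* The end t = 0 gives tan^2(s/2) and the end t = PI gives cot^2(s/2); inverting the former makes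
     both logarithms multiples of ln(cot(s/2)). *)
  replace ((- (sin (s / 2) / cos (s / 2))) ^ 2)
    with (/ (cos (s / 2) / sin (s / 2)) ^ 2) by (field; lra).
  assert (0 < cos (s / 2) / sin (s / 2)) by now apply Rdiv_lt_0_compat.
  rewrite ln_Rinv by now apply pow_lt.
  rewrite ln_pow by easy; simpl; field; lra.
Qed.

(** * Integrals of the second differences in k *)

(** The real part of the second difference; [pv_sin_multiple] is the imaginary part. Nothing is
    singular at t = s, so [phi] also serves as [psi]. *)
Lemma pv_cos_multiple (L s k : R) : 0 < L -> 0 < s < PI -> k <> 0 ->
  has_antiderivative_pv
    (fun y => 4 * sin (theta L s y - s) ^ 2 * cos (k * (theta L s y - s)) / y ^ 2)
    (4 * sin s ^ 2 / (L * k) * (sin (k * s) + sin (k * (PI - s)))).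
Proof.
intros HL Hs Hk.
set (phi := fun t => - (4 * sin s ^ 2 / (L * k)) * sin (k * (t - s))).
assert (D : forall t, is_derive phi t (- (4 * sin s ^ 2 / L) * cos (k * (t - s)))).
{ intros t; unfold phi; auto_derive; [trivial|unfold Rminus; field; lra]. }
assert (Cphi : forall t, continuous phi t).
{ intros t; apply (ex_derive_continuous (V := R_NormedModule)); eexists; apply D. }
apply (has_antiderivative_pv_theta L s phi
  (fun t => - (4 * sin s ^ 2 / L) * cos (k * (t - s))) phi); try easy.
- intros t _ _; apply (ex_derive_continuous (V := R_NormedModule)); now auto_derive.
- intros y Hy; cbv beta; generalize (sin2_div_y2 L s y HL Hs Hy); intros E1.
  transitivity (4 * (sin (theta L s y - s) ^ 2 / y ^ 2) * cos (k * (theta L s y - s)));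
    [field; easy|rewrite E1; field; lra].
- unfold phi; replace (k * (0 - s)) with (- (k * s)) by ring; rewrite sin_neg; ring.
Qed.

Lemma pv_sin_multiple (L s k : R) : 0 < L -> 0 < s < PI -> k <> 0 ->
  has_antiderivative_pv
    (fun y => 4 * sin (theta L s y - s) ^ 2 * sin (k * (theta L s y - s)) / y ^ 2)
    (4 * sin s ^ 2 / (L * k) * (cos (k * s) - cos (k * (PI - s)))).
Proof.
intros HL Hs Hk.
set (phi := fun t => 4 * sin s ^ 2 / (L * k) * cos (k * (t - s))).
assert (D : forall t, is_derive phi t (- (4 * sin s ^ 2 / L) * sin (k * (t - s)))).
{ intros t; unfold phi; auto_derive; [trivial|unfold Rminus; field; lra]. }
assert (Cphi : forall t, continuous phi t).
{ intros t; apply (ex_derive_continuous (V := R_NormedModule)); eexists; apply D. }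
apply (has_antiderivative_pv_theta L s phi
  (fun t => - (4 * sin s ^ 2 / L) * sin (k * (t - s))) phi); try easy.
- intros t _ _; apply (ex_derive_continuous (V := R_NormedModule)); now auto_derive.
- intros y Hy; cbv beta; generalize (sin2_div_y2 L s y HL Hs Hy); intros E1.
  transitivity (4 * (sin (theta L s y - s) ^ 2 / y ^ 2) * sin (k * (theta L s y - s)));
    [field; easy|rewrite E1; field; lra].
- unfold phi; replace (k * (0 - s)) with (- (k * s)) by ring; rewrite cos_neg; ring.
Qed.

(** * Complex form and recurrence in k *)

Definition has_antiderivative_pv_C (f : R -> C) (v : C) : Prop :=
  has_antiderivative_pv (fun y => fst (f y)) (fst v) /\
  has_antiderivative_pv (fun y => snd (f y)) (snd v).

Lemma has_antiderivative_pv_C_lin_comb (f g h : R -> C) (a b : R) (v w z : C) :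
  has_antiderivative_pv_C f v -> has_antiderivative_pv_C g w ->
  (forall y, y <> 0 -> h y = (RtoC a * f y + RtoC b * g y)%C) ->
  z = (RtoC a * v + RtoC b * w)%C -> has_antiderivative_pv_C h z.
Proof.
intros [F1 F2] [G1 G2] Hh ->; split.
- apply (has_antiderivative_pv_lin_comb _ _ _ a b _ _ _ F1 G1).
  + intros y Hy; rewrite Hh by easy; simpl; ring.
  + simpl; ring.
- apply (has_antiderivative_pv_lin_comb _ _ _ a b _ _ _ F2 G2).
  + intros y Hy; rewrite Hh by easy; simpl; ring.
  + simpl; ring.
Qed.

(** A complex factor mixes the components, so each component of the product is a real combination of
    both components of [f]. *)
Lemma has_antiderivative_pv_C_mult (a : C) (f h : R -> C) (v z : C) :
  has_antiderivative_pv_C f v ->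
  (forall y, y <> 0 -> h y = (a * f y)%C) -> z = (a * v)%C ->
  has_antiderivative_pv_C h z.
Proof.
intros [F1 F2] Hh ->; split.
- apply (has_antiderivative_pv_lin_comb _ _ _ (fst a) (- snd a) _ _ _ F1 F2).
  + intros y Hy; rewrite Hh by easy; simpl; ring.
  + simpl; ring.
- apply (has_antiderivative_pv_lin_comb _ _ _ (fst a) (snd a) _ _ _ F2 F1).
  + intros y Hy; rewrite Hh by easy; simpl; ring.
  + simpl; ring.
Qed.

Lemma expi_plus (x y : R) : expi (x + y) = (expi x * expi y)%C.
Proof. unfold expi, Cmult; simpl; rewrite cos_plus, sin_plus; f_equal; ring. Qed.

Lemma expi_0 : expi 0 = RtoC 1.
Proof. unfold expi; now rewrite cos_0, sin_0. Qed.

(** The two neighbours of e^(ikt) add up to 2 cos(2t) e^(ikt), and 2 cos(2t) = 2 - 4 sin^2(t). *)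
Lemma expi_second_difference (k t : R) :
  (expi ((k + 2) * t) = RtoC (2 - 4 * sin t ^ 2) * expi (k * t) - expi ((k - 2) * t))%C.
Proof.
replace ((k + 2) * t) with (k * t + 2 * t) by ring.
replace ((k - 2) * t) with (k * t - 2 * t) by ring.
unfold expi, Cminus, Cplus, Copp, Cmult, RtoC; simpl.
rewrite cos_plus, sin_plus, cos_minus, sin_minus, sin_2a, cos_2a_sin; f_equal; ring.
Qed.

(* The integrand of the half Laplacian of e^(iks), divided by e^(iks). *)
Definition quotient (L s k y : R) : C :=
  ((1 - expi (k * (theta L s y - s))) * RtoC (/ y ^ 2))%C.

(** This is 8 i sin^2(s) e^(-iks) / (L k), in components. *)
Definition quotient_pv_step (L s k : R) : C :=
  (8 * sin s ^ 2 / (L * k) * sin (k * s), 8 * sin s ^ 2 / (L * k) * cos (k * s)).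

(** The two trigonometric hypotheses say that k is an odd integer. They fold the contribution of the
    end t = PI onto that of t = 0. *)
Lemma quotient_recurrence (L s k : R) (v w : C) :
  0 < L -> 0 < s < PI -> k <> 0 -> (forall x, cos (k * PI - x) = - cos x) ->
  (forall x, sin (k * PI - x) = sin x) ->
  has_antiderivative_pv_C (quotient L s (k - 2)) v ->
  has_antiderivative_pv_C (quotient L s k) w ->
  has_antiderivative_pv_C (quotient L s (k + 2))
    (2 * w - v + quotient_pv_step L s k)%C.
Proof.
intros HL Hs Hk Hc Hsn Hv Hw.
assert (Hstep : has_antiderivative_pv_C
  (fun y => RtoC (4 * sin (theta L s y - s) ^ 2 / y ^ 2)
     * expi (k * (theta L s y - s)))%C (quotient_pv_step L s k)).
{ split.
  - apply (has_antiderivative_pv_lin_comb _ _ _ 1 0 _ _ _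
      (pv_cos_multiple L s k HL Hs Hk) (pv_cos_multiple L s k HL Hs Hk)).
    + intros y Hy; simpl; field; easy.
    + replace (k * (PI - s)) with (k * PI - k * s) by ring.
      rewrite Hsn; simpl; field; lra.
  - apply (has_antiderivative_pv_lin_comb _ _ _ 1 0 _ _ _
      (pv_sin_multiple L s k HL Hs Hk) (pv_sin_multiple L s k HL Hs Hk)).
    + intros y Hy; simpl; field; easy.
    + replace (k * (PI - s)) with (k * PI - k * s) by ring.
      rewrite Hc; simpl; field; lra. }
refine (has_antiderivative_pv_C_lin_comb
  (fun y => 2 * quotient L s k y - quotient L s (k - 2) y)%C
  _ _ 1 1 (2 * w - v)%C _ _ _ Hstep _ _); [| |ring].
- apply (has_antiderivative_pv_C_lin_comb _ _ _ 2 (- (1)) _ _ _ Hw Hv).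
  + intros y _; rewrite RtoC_opp; ring.
  + rewrite RtoC_opp; ring.
(* The constants 1 of the three quotients cancel, and 4 sin^2(tau) e^(ik tau) / y^2 is left. *)
- intros y Hy; unfold quotient; rewrite expi_second_difference.
  unfold Rdiv; rewrite !RtoC_mult, !RtoC_minus, !RtoC_mult; ring.
Qed.

Definition log_factor (s : R) : R := cos s + sin s ^ 2 * ln (cot (s / 2)).

(** The cos(s) inside [log_factor] cancels the real part of e^(-is). *)
Lemma quotient_pv_1 (L s : R) : 0 < L -> 0 < s < PI ->
  has_antiderivative_pv_C (quotient L s 1)
    (2 * Ci / RtoC L * (expi (- s) - RtoC (log_factor s)))%C.
Proof.
intros HL Hs.
assert (HC := pv_one_minus_cos L s HL Hs); assert (HS := pv_sin L s HL Hs).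
split.
- apply (has_antiderivative_pv_lin_comb _ _ _ 1 0 _ _ _ HC HC).
  + intros y Hy; unfold quotient, expi; simpl; rewrite Rmult_1_l; field; easy.
  + unfold expi; simpl; rewrite cos_neg, sin_neg; field; lra.
- apply (has_antiderivative_pv_lin_comb _ _ _ (-1) 0 _ _ _ HS HS).
  + intros y Hy; unfold quotient, expi; simpl; rewrite Rmult_1_l; field; easy.
  + unfold expi, log_factor; simpl; rewrite cos_neg, sin_neg; field; lra.
Qed.

Lemma quotient_pv_minus_1 (L s : R) : 0 < L -> 0 < s < PI ->
  has_antiderivative_pv_C (quotient L s (- 1))
    (- (2 * Ci / RtoC L) * (expi s - RtoC (log_factor s)))%C.
Proof.
intros HL Hs.
assert (HC := pv_one_minus_cos L s HL Hs); assert (HS := pv_sin L s HL Hs).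
split.
- apply (has_antiderivative_pv_lin_comb _ _ _ 1 0 _ _ _ HC HC).
  + intros y Hy; unfold quotient, expi; simpl.
    replace (-1 * (theta L s y - s)) with (- (theta L s y - s)) by ring.
    rewrite cos_neg; field; easy.
  + unfold expi; simpl; field; lra.
- apply (has_antiderivative_pv_lin_comb _ _ _ 1 0 _ _ _ HS HS).
  + intros y Hy; unfold quotient, expi; simpl.
    replace (-1 * (theta L s y - s)) with (- (theta L s y - s)) by ring.
    rewrite sin_neg; field; easy.
  + unfold expi, log_factor; simpl; field; lra.
Qed.

(** * The closed form of the principal values *)

(** Eight times the value at -j is 2/(2j+1) - 1/(2j-1) - 1/(2j+3), the coefficient that 4 sin^2(s) =
    2 - e^(2is) - e^(-2is) produces from a sum of terms e^(-iks)/k over odd k. The value at 0 is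
    1/3, so one formula covers both nonzero cases of the sequence [c]. *)
Definition kernel_coeff (x : R) : R := 1 / ((2 * x - 3) * (2 * x - 1) * (2 * x + 1)).

Fixpoint kernel_sum (s : R) (m : nat) : C :=
  match m with
  | O => 0
  | S m => (kernel_sum s m
      + RtoC (kernel_coeff (- INR m)) * expi (- ((2 * INR m + 1) * s)))%C
  end.

(* Here k = 2 m - 1, so that m = 0 and m = 1 are the two initial values k = -1
   and k = 1 of the recurrence. *)
Definition quotient_pv (L s : R) (m : nat) : C :=
  (RtoC (2 / L) * Ci *
    (RtoC (4 * (2 * INR m - 1)) * kernel_sum s m
     - RtoC (/ (2 * INR m + 1)) * expi (- ((2 * INR m - 1) * s))
     - RtoC ((2 * INR m - 1) * log_factor s)))%C.

Lemma odd_INR_neq_0 (m : nat) : 2 * INR m - 1 <> 0.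
Proof.
destruct m as [|m]; [simpl; lra|rewrite S_INR; generalize (pos_INR m); lra].
Qed.

(** The factors 4(2m-1) and 2m-1 are affine in m, so the second difference kills [kernel_sum s m]
    and [log_factor s]. What remains is a linear relation between e^(-i(k-2)s), e^(-iks) and
    e^(-i(k+2)s) for k = 2m+1. *)
Lemma quotient_pv_recurrence (L s : R) (m : nat) : 0 < L ->
  (quotient_pv L s (S (S m)) = 2 * quotient_pv L s (S m) - quotient_pv L s m
     + quotient_pv_step L s (2 * INR m + 1))%C.
Proof.
intros HL.
unfold quotient_pv, quotient_pv_step; cbn [kernel_sum]; rewrite !S_INR.
(* All arguments become (k + j)(-s) with j in {-2, 0, 2}, so that [expi_second_difference] can
   eliminate j = 2. *)
replace (- ((2 * (INR m + 1) + 1) * s)) with ((2 * INR m + 1 + 2) * - s) by ring.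
replace (- ((2 * (INR m + 1 + 1) - 1) * s)) with ((2 * INR m + 1 + 2) * - s) by ring.
replace (- ((2 * (INR m + 1) - 1) * s)) with ((2 * INR m + 1) * - s) by ring.
replace (- ((2 * INR m - 1) * s)) with ((2 * INR m + 1 - 2) * - s) by ring.
replace (- ((2 * INR m + 1) * s)) with ((2 * INR m + 1) * - s) by ring.
rewrite expi_second_difference, sin_neg.
replace (sin ((2 * INR m + 1) * s)) with (- sin ((2 * INR m + 1) * - s))
  by (rewrite <- sin_neg; f_equal; ring).
replace (cos ((2 * INR m + 1) * s)) with (cos ((2 * INR m + 1) * - s))
  by (rewrite <- cos_neg; f_equal; ring).
generalize (odd_INR_neq_0 m) (pos_INR m); intros H1 H2.
unfold expi, kernel_coeff, Ci, Cminus, Cplus, Copp, Cmult, RtoC.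
destruct (kernel_sum s m) as [q1 q2].
cbn [fst snd].
f_equal; field; repeat split; lra.
Qed.

(** The recurrence reaches back two steps, so the induction carries two consecutive odd values of
    k. *)
Lemma quotient_has_pv (L s : R) (m : nat) : 0 < L -> 0 < s < PI ->
  has_antiderivative_pv_C (quotient L s (2 * INR m - 1)) (quotient_pv L s m) /\
  has_antiderivative_pv_C (quotient L s (2 * INR m + 1)) (quotient_pv L s (S m)).
Proof.
intros HL Hs; induction m as [|m [IH1 IH2]].
- split.
  + replace (2 * INR 0 - 1) with (- 1) by (simpl; ring).
    replace (quotient_pv L s 0)
      with (- (2 * Ci / RtoC L) * (expi s - RtoC (log_factor s)))%C;
      [now apply quotient_pv_minus_1|].
    unfold quotient_pv; simpl.
    replace (- ((2 * 0 - 1) * s)) with s by ring.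
    unfold expi, Ci, Cdiv, Cinv, Cminus, Cplus, Copp, Cmult, RtoC; simpl.
    f_equal; field; lra.
  + replace (2 * INR 0 + 1) with 1 by (simpl; ring).
    replace (quotient_pv L s 1)
      with (2 * Ci / RtoC L * (expi (- s) - RtoC (log_factor s)))%C;
      [now apply quotient_pv_1|].
    (* The coefficient of e^(-is) is 4/3 - 1/3 = 1. *)
    unfold quotient_pv; simpl.
    replace (- ((2 * 1 - 1) * s)) with (- s) by ring.
    replace (- ((2 * 0 + 1) * s)) with (- s) by ring.
    unfold expi, Ci, Cdiv, Cinv, Cminus, Cplus, Copp, Cmult, RtoC; simpl.
    unfold kernel_coeff; f_equal; field; lra.
- split.
  + replace (2 * INR (S m) - 1) with (2 * INR m + 1) by (rewrite S_INR; ring); easy.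
  + rewrite quotient_pv_recurrence by easy.
    replace (2 * INR (S m) + 1) with (2 * INR m + 1 + 2) by (rewrite S_INR; ring).
    apply quotient_recurrence; try easy.
    * generalize (pos_INR m); lra.
    * intros x; replace ((2 * INR m + 1) * PI - x)
        with (PI - x + 2 * INR m * PI) by ring.
      rewrite cos_period, cos_minus, cos_PI, sin_PI; ring.
    * intros x; replace ((2 * INR m + 1) * PI - x)
        with (PI - x + 2 * INR m * PI) by ring.
      rewrite sin_period, sin_minus, cos_PI, sin_PI; ring.
    * replace (2 * INR m + 1 - 2) with (2 * INR m - 1) by ring; easy.
Qed.

(** Restores the factor e^(iks) divided out in [quotient]. *)
Lemma half_laplacian_expi_odd (L s : R) (n : nat) : 0 < L -> 0 < s < PI ->
  half_laplacian_expi L (2 * Z.of_nat n + 1) s =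
  (RtoC (/ PI) * (expi ((2 * INR n + 1) * s) * quotient_pv L s (S n)))%C.
Proof.
intros HL Hs; unfold half_laplacian_expi, half_laplacian.
replace (1 / PI) with (/ PI) by (field; apply PI_neq0); f_equal.
apply is_principal_value_unique.
assert (Hk : IZR (2 * Z.of_nat n + 1) = 2 * INR n + 1).
{ rewrite plus_IZR, mult_IZR, <- INR_IZR_INZ; ring. }
rewrite Hk; clear Hk.
destruct (has_antiderivative_pv_C_mult (expi ((2 * INR n + 1) * s))
  (quotient L s (2 * INR n + 1))
  (fun y => (expi ((2 * INR n + 1) * arccot (L * cot s / L))
     - expi ((2 * INR n + 1) * arccot ((L * cot s + y) / L))) / RtoC (y ^ 2))%C
  (quotient_pv L s (S n))
  (expi ((2 * INR n + 1) * s) * quotient_pv L s (S n))%C) as [H1 H2].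
- now apply quotient_has_pv.
- intros y Hy; unfold quotient.
  replace (L * cot s / L) with (cot s) by (field; lra).
  rewrite arccot_cot by easy; fold (theta L s y).
  replace ((2 * INR n + 1) * theta L s y)
    with ((2 * INR n + 1) * s + (2 * INR n + 1) * (theta L s y - s)) by ring.
  rewrite expi_plus; unfold Cdiv; rewrite <- RtoC_inv by now apply pow_nonzero.
  ring.
- reflexivity.
- now apply is_principal_value_C.
Qed.

(** * Finite sums and the discrete convolution *)

Lemma sum_n_zero_tail {G : AbelianMonoid} (u : nat -> G) (m n : nat) :
  (m <= n)%nat -> (forall k, (m < k <= n)%nat -> u k = zero) ->
  sum_n u n = sum_n u m.
Proof.
intros Hmn; induction Hmn as [|n Hmn IH]; intros Hu; [easy|].
rewrite sum_Sn, IH by (intros k Hk; apply Hu; lia).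
rewrite (Hu (S n)) by lia; apply plus_zero_r.
Qed.

(** Reduces the final identity between four sums to one identity per index. *)
Lemma sum_n_lin_comb_C (x y z : C) (f g h u : nat -> C) (m : nat) :
  (forall n, (n <= m)%nat -> u n = (x * f n + y * g n - z * h n)%C) ->
  sum_n (G := C_AbelianMonoid) u m =
  (x * sum_n (G := C_AbelianMonoid) f m + y * sum_n (G := C_AbelianMonoid) g m
   - z * sum_n (G := C_AbelianMonoid) h m)%C.
Proof.
induction m as [|m IH]; intros Hu.
- rewrite !sum_O; now apply Hu.
- rewrite !sum_Sn, IH by (intros n Hn; apply Hu; lia).
  rewrite (Hu (S m)) by lia; unfold plus; simpl; ring.
Qed.

(** Reversing the summation by l = n - j turns e^(i(2n+1)s) e^(-i(2j+1)s) into e^(2ils) and the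
    coefficient at -j into the one at l - n, which is the shape of a convolution. *)
Lemma kernel_sum_reverse (s : R) (n : nat) :
  (expi ((2 * INR n + 1) * s) * kernel_sum s (S n))%C =
  sum_n (G := C_AbelianMonoid)
    (fun l => (RtoC (kernel_coeff (INR l - INR n)) * expi (2 * INR l * s))%C) n.
Proof.
induction n as [|n IH].
- rewrite sum_O; simpl.
  replace (2 * 0 * s) with 0 by ring; replace (0 - 0) with (- 0) by ring.
  rewrite expi_0.
  transitivity (RtoC (kernel_coeff (- 0)) *
    (expi ((2 * 0 + 1) * s) * expi (- ((2 * 0 + 1) * s))))%C; [ring|].
  rewrite <- expi_plus, Rplus_opp_r, expi_0; ring.
(* Raising l and n together leaves l - n unchanged and multiplies each exponential by e^(2is). *)
- assert (Hshift : sum_n (G := C_AbelianMonoid) (fun l =>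
      (RtoC (kernel_coeff (INR (S l) - INR (S n))) * expi (2 * INR (S l) * s))%C) n =
    (expi (2 * s) * (expi ((2 * INR n + 1) * s) * kernel_sum s (S n)))%C).
  { rewrite IH.
    refine (eq_trans _ (sum_n_mult_l (K := C_Ring) _ _ _)).
    apply sum_n_ext; intros l; rewrite !S_INR.
    replace (INR l + 1 - (INR n + 1)) with (INR l - INR n) by ring.
    replace (2 * (INR l + 1) * s) with (2 * s + 2 * INR l * s) by ring.
    rewrite expi_plus; unfold mult; simpl; ring. }
  (* The term l = 0, split off here, is the one that [kernel_sum] gains at this step. *)
  unfold sum_n in Hshift |- *; rewrite sum_Sn_m by lia.
  rewrite <- sum_n_m_S, Hshift.
  change (kernel_sum s (S (S n))) with (kernel_sum s (S n) +
    RtoC (kernel_coeff (- INR (S n))) * expi (- ((2 * INR (S n) + 1) * s)))%C.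
  replace (INR 0 - INR (S n)) with (- INR (S n)) by (change (INR 0) with 0; ring).
  replace (2 * INR 0 * s) with 0 by (simpl; ring).
  change (plus (G := C_AbelianMonoid)) with Cplus.
  rewrite expi_0.
  transitivity (expi ((2 * INR (S n) + 1) * s) * kernel_sum s (S n)
    + RtoC (kernel_coeff (- INR (S n))) *
    (expi ((2 * INR (S n) + 1) * s) * expi (- ((2 * INR (S n) + 1) * s))))%C; [ring|].
  rewrite <- expi_plus, Rplus_opp_r, expi_0.
  replace ((2 * INR (S n) + 1) * s) with (2 * s + (2 * INR n + 1) * s)
    by (rewrite S_INR; ring).
  rewrite expi_plus; ring.
Qed.

(** For l and n in 0 .. M, the difference l - n lies between -M and M. A negative one moves by one
    period into the range of [c_high]; a positive one is at most M <= P - M - 1, where [c] vanishes.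
    Only n >= l contributes, and exchanging the sums gives the reversed kernel sums. *)
Lemma conv_kernel (M P : nat) (b c : Z -> C) (s : R)
  (HP : (2 * M + 1 <= P)%nat)
  (b_high : forall l : nat, (M + 1 <= l <= P - 1)%nat -> b (Z.of_nat l) = RtoC 0)
  (c_periodic : periodic P c)
  (c_zero : c 0%Z = RtoC (1 / 3))
  (c_mid : forall l : nat, (1 <= l <= P - M - 1)%nat -> c (Z.of_nat l) = RtoC 0)
  (c_high : forall l : nat, (P - M <= l <= P - 1)%nat ->
     c (Z.of_nat l) = RtoC (kernel_coeff (INR l - INR P))) :
  sum_n (G := C_AbelianMonoid)
    (fun l : nat => (conv P b c (Z.of_nat l) * expi (2 * INR l * s))%C) M =
  sum_n (G := C_AbelianMonoid)
    (fun n => (b (Z.of_nat n) *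
       (expi ((2 * INR n + 1) * s) * kernel_sum s (S n)))%C) M.
Proof.
assert (c_low : forall l n : nat, (l <= n <= M)%nat ->
  c (Z.of_nat l - Z.of_nat n)%Z = RtoC (kernel_coeff (INR l - INR n))).
{ intros l n H; destruct (Nat.eq_dec l n) as [->|Hln].
  - rewrite Z.sub_diag, c_zero; unfold kernel_coeff; f_equal; field; lra.
  - rewrite <- c_periodic.
    replace (Z.of_nat l - Z.of_nat n + Z.of_nat P)%Z with (Z.of_nat (P + l - n)) by lia.
    rewrite c_high by lia; rewrite minus_INR, plus_INR by lia; do 2 f_equal; ring. }
rewrite (sum_n_ext_loc (G := C_AbelianMonoid) _
  (fun l => sum_n (G := C_AbelianMonoid) (fun n =>
    (b (Z.of_nat n) * c (Z.of_nat l - Z.of_nat n)%Z * expi (2 * INR l * s))%C) M)).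
2:{ intros l Hl; unfold conv.
    rewrite (sum_n_zero_tail _ M (P - 1)); [|lia|].
    - rewrite <- (sum_n_mult_r (K := C_Ring)); reflexivity.
    - intros k Hk; rewrite b_high by lia; unfold zero; simpl; ring. }
rewrite sum_n_switch.
apply sum_n_ext_loc; intros n Hn.
rewrite kernel_sum_reverse.
rewrite (sum_n_zero_tail _ n M); [|lia|].
- rewrite <- (sum_n_mult_l (K := C_Ring)).
  apply sum_n_ext_loc; intros l Hl; rewrite c_low by lia.
  unfold mult; simpl; ring.
(* Here l > n; this is where P >= 2M + 1 excludes aliasing. *)
- intros l Hl.
  replace (Z.of_nat l - Z.of_nat n)%Z with (Z.of_nat (l - n)) by lia.
  rewrite c_mid by lia; unfold zero; simpl; ring.
Qed.

(** * Assembly of the formula *)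

Theorem lemma3p1 (L : R) (M : nat) (a : nat -> C) (s : R) (P : nat)
  (b c : Z -> C)
  (HL : 0 < L) (Hs : 0 < s < PI) (HP : (2 * M + 1 <= P)%nat)
  (b_periodic : periodic P b)
  (b_low : forall l : nat, (l <= M)%nat ->
     b (Z.of_nat l) = (RtoC (8 * INR l + 4) * a l)%C)
  (b_high : forall l : nat, (M + 1 <= l <= P - 1)%nat ->
     b (Z.of_nat l) = RtoC 0)
  (c_periodic : periodic P c)
  (c_zero : c 0%Z = RtoC (1 / 3))
  (c_mid : forall l : nat, (1 <= l <= P - M - 1)%nat ->
     c (Z.of_nat l) = RtoC 0)
  (c_high : forall l : nat, (P - M <= l <= P - 1)%nat ->
     c (Z.of_nat l) =
       RtoC (1 / ((2 * (INR l - INR P) - 3) * (2 * (INR l - INR P) - 1)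
                  * (2 * (INR l - INR P) + 1)))) :
  sum_n (G := C_AbelianMonoid)
    (fun l : nat => (a l * half_laplacian_expi L (2 * Z.of_nat l + 1) s)%C) M
  = (- (2 * Ci / RtoC (L * PI))
       * sum_n (G := C_AbelianMonoid)
           (fun l : nat => (a l / RtoC (2 * INR l + 3))%C) M
     + 2 * Ci / RtoC (L * PI)
       * sum_n (G := C_AbelianMonoid)
           (fun l : nat =>
              (conv P b c (Z.of_nat l) * expi (2 * INR l * s))%C) M
     - 2 * Ci / RtoC (L * PI)
       * RtoC (cos s + sin s ^ 2 * ln (cot (s / 2)))
       * sum_n (G := C_AbelianMonoid)
           (fun l : nat =>
              (RtoC (2 * INR l + 1) * a l * expi ((2 * INR l + 1) * s))%C) M)%C.
Proof.
(* Once the convolution is summed over n, all four sums share an index and the identity holds term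
   by term. *)
rewrite (conv_kernel M P b c s HP b_high c_periodic c_zero c_mid c_high).
apply sum_n_lin_comb_C; intros n Hn.
rewrite half_laplacian_expi_odd, b_low by easy.
fold (log_factor s); unfold quotient_pv; rewrite S_INR.
replace (4 * (2 * (INR n + 1) - 1)) with (8 * INR n + 4) by ring.
replace (2 * (INR n + 1) + 1) with (2 * INR n + 3) by ring.
replace (2 * (INR n + 1) - 1) with (2 * INR n + 1) by ring.
(* This product strips the exponential from the term in 1/(2n+3), giving the constant first sum. *)
assert (E : (expi ((2 * INR n + 1) * s) * expi (- ((2 * INR n + 1) * s)) = 1)%C)
  by (rewrite <- expi_plus, Rplus_opp_r; apply expi_0).
assert (0 < L * PI) by (apply Rmult_lt_0_compat; lra).
assert (0 < 2 * INR n + 3) by (generalize (pos_INR n); lra).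
unfold Cdiv; rewrite <- !RtoC_inv, Rinv_mult by lra.
unfold Rdiv; rewrite !RtoC_mult.
set (e := expi ((2 * INR n + 1) * s)) in *.
set (e' := expi (- ((2 * INR n + 1) * s))) in *.
set (r := RtoC (/ (2 * INR n + 3))); set (k := kernel_sum s (S n)).
transitivity (RtoC (/ PI) * RtoC 2 * RtoC (/ L) * Ci * a n *
  (RtoC (8 * INR n + 4) * (e * k) - r * (e * e')
   - RtoC (2 * INR n + 1) * RtoC (log_factor s) * e))%C; [ring|].
rewrite E; ring.
Qed.
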